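(* There is an absolute constant $C>0$ such that the following holds. Let $G$ be a strongly regular graph with parameters $(n,k,\lambda,\mu)$, $k\le (n-1)/2$, and adjacency eigenvalues $k\ge r>s$, satisfying the claw bound \[ r \le \max\left\{2(-s-1)(\mu+1+s)+s,\ \frac{s(s+1)(\mu+1)}{2}-1\right\}. \] Then $r/n \le C\, g(n,k)$, where \[ g(n,k) = \min\left\{\left(\frac{k}{n}\right)^{4/3},\ \frac{k^{1/2}}{n^{3/4}},\ \max\left\{\left(\frac{k}{n}\right)^{3/2},\ \left(\frac{1}{n}\right)^{1/2}\right\}\right\}. \]
   Context: A strongly regular graph with parameters $(n,k,\lambda,\mu)$ is a $k$-regular graph on $n$ vertices in which any two adjacent vertices have exactly $\lambda$ common neighbors and any two distinct nonadjacent vertices have exactly $\mu$ common neighbors. Its adjacency eigenvalues are $k$ and two other (restricted) eigenvalues $r>s$, with $k\ge r$. *)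

(* Defs.v *)
From mathcomp Require Import all_boot all_order all_algebra.
From mathcomp Require Import reals exp.
Set Implicit Arguments. Unset Strict Implicit. Unset Printing Implicit Defensive.
Import Order.TTheory GRing.Theory Num.Theory.
Local Open Scope ring_scope.

Definition common_nbrs (n : nat) (e : rel 'I_n) (x y : 'I_n) : {set 'I_n} :=
  [set z | e x z && e y z].

Definition srg (n k lam mu : nat) (e : rel 'I_n) : Prop :=
  [/\ symmetric e, irreflexive e,
      (forall x : 'I_n, #|[set y | e x y]| = k),
      (forall x y : 'I_n, x != y -> e x y -> #|common_nbrs e x y| = lam) &
      (forall x y : 'I_n, x != y -> ~~ e x y -> #|common_nbrs e x y| = mu)].

Definition adjmx (R : nzRingType) (n : nat) (e : rel 'I_n) : 'M[R]_n :=
  \matrix_(i, j) (e i j)%:R.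

Definition gfun (R : realType) (n k : nat) : R :=
  let nR := n%:R in let kR := k%:R in
  Num.min ((kR / nR) `^ (4%:R / 3%:R))
   (Num.min ((kR `^ (2%:R^-1)) / (nR `^ (3%:R / 4%:R)))
            (Num.max ((kR / nR) `^ (3%:R / 2%:R)) ((1 / nR) `^ (2%:R^-1)))).

(* Main.v *)
Require Import Defs.
From mathcomp Require Import all_boot all_order all_algebra.
From mathcomp Require Import reals exp.
From mathcomp Require Import zify ring lra.
Set Implicit Arguments. Unset Strict Implicit. Unset Printing Implicit Defensive.

(** Write [m := - s]. The quadratic equation of the adjacency matrix gives
    [r - m = lam - mu], [r m = k - mu] and [(k - r)(k + m) = n mu], hence
    [mu <= 3 k^2 / n] and [r m <= k]; the claw bound yields [r <= 2 m^2 mu].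

    - The first term of the minimum: [r^3 <= 2 (r m)^2 mu <= 6 k^4 / n].
    - The second: if [f] is the multiplicity of [r] then [f r <= m n], and the
      absolute bound [n <= (f + 1)(f + 2)] gives [r <= O(m sqrt n)], so
      [r^2 <= O(k sqrt n)].
    - The third: unless [r^2 = O(k^3 / n)] we have [k mu <= lam^2 / 32], and then
      (Metsch) the neighbourhood of a vertex is almost a disjoint union of
      cliques of size about [lam]. Take a maximum clique [K]. The large cliques
      meeting [K] contain almost all of the [k #|K|] edges leaving [K], while
      those through a fixed vertex outside [K] meet only in that vertex, so
      there are at most [2 k / lam] of them. Hence [lam^2 = O(n)]. *)

(** * Large cliques in strongly regular graphs *)

Definition nbrs (n : nat) (e : rel 'I_n) (x : 'I_n) : {set 'I_n} :=
  [set y | e x y].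

Definition cliqueb (n : nat) (e : rel 'I_n) (K : {set 'I_n}) : bool :=
  [forall u in K, forall v in K, (u != v) ==> e u v].

Definition indepb (n : nat) (e : rel 'I_n) (S : {set 'I_n}) : bool :=
  [forall u in S, forall v in S, ~~ e u v].

Lemma cliqueP (n : nat) (e : rel 'I_n) (K : {set 'I_n}) :
  reflect {in K &, forall u v, u != v -> e u v} (cliqueb e K).
Proof.
apply: (iffP forall_inP) => [h u v uK vK uv | h u uK].
  by have /forall_inP/(_ v vK)/implyP/(_ uv) := h u uK.
by apply/forall_inP => v vK; apply/implyP; apply: h.
Qed.

Lemma indepP (n : nat) (e : rel 'I_n) (S : {set 'I_n}) :
  reflect {in S &, forall u v, ~~ e u v} (indepb e S).
Proof.
apply: (iffP forall_inP) => [h u v uS vS | h u uS].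
  by have /forall_inP/(_ v vS) := h u uS.
by apply/forall_inP => v vS; apply: h.
Qed.

Lemma sum_sqr_cauchy (T : finType) (A : {set T}) (d : T -> nat) :
  (\sum_(v in A) d v) ^ 2 <= #|A| * \sum_(v in A) d v ^ 2.
Proof.
rewrite -(leq_pmul2l (isT : 0 < 2)).
have -> : 2 * (\sum_(v in A) d v) ^ 2
    = \sum_(i in A) \sum_(j in A) 2 * (d i * d j).
  rewrite -mulnn big_distrl /= big_distrr /=; apply: eq_bigr => i _.
  by rewrite big_distrr /= big_distrr.
apply: (@leq_trans (\sum_(i in A) \sum_(j in A) (d i ^ 2 + d j ^ 2))).
  by apply: leq_sum => i _; apply: leq_sum => j _; apply: nat_Cauchy.
under eq_bigr do rewrite big_split /= sum_nat_const.
rewrite big_split /= sum_nat_const -big_distrr /=; lia.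
Qed.

Lemma card_bigcup_le (I T : finType) (P : pred I) (F : I -> {set T}) (c : nat) :
  (forall i, P i -> #|F i| <= c) -> #|\bigcup_(i | P i) F i| <= #|P| * c.
Proof.
move=> Fc; apply: (@leq_trans (\sum_(i | P i) #|F i|)).
  apply: (big_ind2 (fun (A : {set T}) m => #|A| <= m)) => [|A m B p hA hB|//].
    by rewrite cards0.
  by apply: leq_trans (leq_card_setU A B) _; apply: leq_add.
by rewrite -sum_nat_const; apply: leq_sum.
Qed.

Lemma card_common_adj (n k lam mu : nat) (e : rel 'I_n) (x y : 'I_n) :
  srg k lam mu e -> e x y -> #|nbrs e x :&: nbrs e y| = lam.
Proof.
case=> _ irr _ hl _ exy.
have -> : nbrs e x :&: nbrs e y = common_nbrs e x y by apply/setP=> z; rewrite !inE.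
by apply: hl => //; apply: contraTneq exy => ->; rewrite irr.
Qed.

Lemma card_common_nonadj (n k lam mu : nat) (e : rel 'I_n) (x y : 'I_n) :
  srg k lam mu e -> x != y -> ~~ e x y -> #|nbrs e x :&: nbrs e y| = mu.
Proof.
case=> _ _ _ _ hm xy exy.
have -> : nbrs e x :&: nbrs e y = common_nbrs e x y by apply/setP=> z; rewrite !inE.
exact: hm.
Qed.

(** Let [d v] count the neighbours of [v] in [S]. Over [nbrs e x] it sums to [#|S| * lam], and its
    squares sum to at most [#|S| * (lam + #|S| * mu)] because distinct members of [S] are
    nonadjacent. Cauchy-Schwarz concludes. *)
Lemma local_indep_card (n k lam mu : nat) (e : rel 'I_n) (x : 'I_n)
    (S : {set 'I_n}) :
  srg k lam mu e -> S \subset nbrs e x -> indepb e S ->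
  #|S| * lam ^ 2 <= k * lam + k * #|S| * mu.
Proof.
move=> G /subsetP SN /indepP indS; have [sym irr deg _ _] := G.
pose d (v : 'I_n) := (\sum_(y in S) e y v)%N.
have e2 (y : 'I_n) (Q : {set 'I_n}) : \sum_(v in Q) e y v = #|Q :&: nbrs e y|.
  rewrite -sum1_card big_mkcond [RHS]big_mkcond; apply: eq_bigr => v _.
  by rewrite !inE; case: (v \in Q); case: (e y v).
have sd : \sum_(v in nbrs e x) d v = #|S| * lam.
  rewrite /d exchange_big /= -sum_nat_const; apply: eq_bigr => y /SN.
  by rewrite inE => xy; rewrite e2 (card_common_adj G).
have sd2 : \sum_(v in nbrs e x) d v ^ 2 <= #|S| * (lam + #|S| * mu).
  have -> : \sum_(v in nbrs e x) d v ^ 2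
      = \sum_(y in S) \sum_(z in S) \sum_(v in nbrs e x) e y v * e z v.
    under [RHS]eq_bigr do rewrite exchange_big /=.
    rewrite [RHS]exchange_big /=; apply: eq_bigr => v _.
    rewrite -mulnn /d big_distrl /=; apply: eq_bigr => y _.
    by rewrite big_distrr.
  rewrite -sum_nat_const; apply: leq_sum => y yS.
  rewrite (bigD1 y) //=; apply: leq_add.
    have xy := SN _ yS; rewrite inE in xy.
    rewrite -(card_common_adj G xy) -e2; apply: leq_sum => v _.
    by case: (e y v).
  apply: (@leq_trans (\sum_(z in S | z != y) mu)).
    apply: leq_sum => z /andP [zS zy].
    rewrite -(card_common_nonadj G zy (indS _ _ zS yS)) -e2.
    rewrite [X in _ <= X]big_mkcond [X in X <= _]big_mkcond; apply: leq_sum => v _.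
    by rewrite !inE; case: (e x v); case: (e y v); case: (e z v).
  rewrite sum_nat_const leq_mul2r; apply/orP; right.
  by apply: subset_leq_card; apply/subsetP => z; rewrite unfold_in => /andP [].
have := sum_sqr_cauchy (nbrs e x) d; rewrite sd deg => h.
have [->|S0] := posnP #|S|; first by lia.
rewrite -(leq_pmul2l S0); apply: leq_trans (_ : (#|S| * lam) ^ 2 <= _).
  by lia.
apply: leq_trans h _; apply: leq_trans (leq_mul (leqnn k) sd2) _.
by lia.
Qed.

(** With the threshold 3/4, two large cliques sharing two vertices overlap in at least about
    [lam / 2] vertices, far more than [mu]. *)
Definition in_large_clique (n lam : nat) (e : rel 'I_n) (x v : 'I_n) : bool :=
  [exists L : {set 'I_n},
    [&& cliqueb e L, x \in L, v \in L & 3 * lam <= 4 * #|L|]].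

(** For a maximum independent set [S] in the neighbourhood, few vertices see two members of [S]. The
    others are grouped by the member they equal or see, and each group together with [x] is a clique
    of size at least about [lam]. *)
Lemma card_not_in_large_clique (n k lam mu : nat) (e : rel 'I_n) (x : 'I_n) :
  srg k lam mu e -> 0 < lam -> 32 * (k * mu) <= lam ^ 2 ->
  8 * #|[set v in nbrs e x | ~~ in_large_clique lam e x v]| <= k.
Proof.
move=> G lam0 hmu; have [sym irr deg _ _] := G.
pose P (S : {set 'I_n}) := (S \subset nbrs e x) && indepb e S.
have P0 : P set0 by rewrite /P sub0set; apply/indepP => u v; rewrite inE.
case: (@arg_maxnP _ set0 P (fun S => #|S|) P0) => S /andP [SN indS] maxS.
have tbd := local_indep_card G SN indS.
move/subsetP: SN => SN; move/indepP: indS => indS.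
set t := #|S| in tbd maxS *.
(* By [hmu], the term [k * t * mu] of [tbd] is at most [t * lam ^ 2 / 32], which the left side
   absorbs. *)
have t1 : 31 * (t * lam) <= 32 * k.
  rewrite -(leq_pmul2r lam0).
  have := leq_mul (leqnn t) hmu; lia.
have t2 : 31 * (t * mu) <= lam.
  rewrite -(leq_pmul2r lam0).
  have := leq_mul t1 (leqnn mu); lia.
have t3 : 8 * (t * (t * mu)) <= k.
  have := leq_mul (leqnn t) t2; lia.
pose U y := \bigcup_(z in S :\ y) (nbrs e y :&: nbrs e z).
have cU y : y \in S -> #|U y| <= t * mu.
  move=> yS; apply: (@leq_trans (#|S :\ y| * mu)).
    apply: card_bigcup_le => z; rewrite !inE => /andP [zy zS].
    by rewrite (card_common_nonadj G) // ?(eq_sym y) // indS.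
  by rewrite leq_mul2r subset_leq_card ?orbT // subD1set.
suff sub : [set v in nbrs e x | ~~ in_large_clique lam e x v]
    \subset \bigcup_(y in S) U y.
  apply: leq_trans t3; rewrite leq_mul2l /=.
  by apply: leq_trans (subset_leq_card sub) _; apply: card_bigcup_le.
pose B y := [set u in nbrs e x |
   (e y u || (u == y)) && [forall z in S :\ y, ~~ e z u]].
have BS y u : y \in S -> u \in B y -> u \notin S :\ y.
  move=> yS; rewrite !inE => /and3P [_ yu _]; apply/negP => /andP [uy uS].
  by move: yu; rewrite (negbTE (indS _ _ yS uS)) (negbTE uy).
have BA y z u : u \in B y -> z \in S :\ y -> ~~ e z u.
  by rewrite inE => /and3P [_ _ /forall_inP h]; apply: h.
(* a nonadjacent pair in [B y] could replace [y] in [S] *)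
have Bclique y : y \in S -> {in B y &, forall u v, u != v -> e u v}.
  move=> yS u v uB vB uv; apply: contraT => euv.
  have uN : u \in nbrs e x by move: uB; rewrite inE => /andP [].
  have vN : v \in nbrs e x by move: vB; rewrite inE => /andP [].
  have PS' : P (u |: (v |: S :\ y)).
    apply/andP; split.
      apply/subsetP => w; rewrite in_setU1 => /orP [/eqP -> //|].
      by rewrite in_setU1 => /orP [/eqP -> //|/setD1P [_ /SN]].
    apply/indepP => a b; rewrite !in_setU1.
    case/or3P => [/eqP->|/eqP->|aS]; case/or3P => [/eqP->|/eqP->|bS];
      rewrite ?irr //.
    - by rewrite sym (BA y).
    - by rewrite sym.
    - by rewrite sym (BA y).
    - by rewrite (BA y).
    - by rewrite (BA y).
    - by case/setD1P: aS => _ aS; case/setD1P: bS => _ bS; apply: indS.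
  have := maxS _ PS'.
  rewrite cardsU1 in_setU1 (negbTE uv) (negbTE (BS _ _ yS uB)) /=.
  by rewrite cardsU1 (negbTE (BS _ _ yS vB)) /= /t (cardsD1 y S) yS !add1n ltnn.
apply/subsetP => v; rewrite inE => /andP [vN]; apply: contraR => vU.
have nU y z : y \in S -> z \in S :\ y -> ~~ (e y v && e z v).
  move=> yS zS; apply: contra vU => yz; apply/bigcupP; exists y => //.
  by apply/bigcupP; exists z => //; rewrite !inE.
(* A vertex outside [S] seeing no member could be added to [S]; one seeing two would lie in some
   [U y]. *)
have [y yS vB] : exists2 y, y \in S & v \in B y.
  have [vS|vS] := boolP (v \in S).
    exists v => //; rewrite inE vN eqxx orbT /=.
    by apply/forall_inP => z /setD1P [_ zS]; apply: indS.
  have [/exists_inP [y yS yv]|/exists_inPn nS] := boolP [exists y in S, e y v].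
    exists y => //; rewrite inE vN yv /=; apply/forall_inP => z zS.
    by have := nU _ _ yS zS; rewrite yv.
  have PS' : P (v |: S).
    apply/andP; split.
      by apply/subsetP => w; rewrite in_setU1 => /orP [/eqP -> //|/SN].
    apply/indepP => a b; rewrite !in_setU1.
    case/orP => [/eqP->|aS]; case/orP => [/eqP->|bS]; rewrite ?irr //.
    - by rewrite sym nS.
    - by rewrite nS.
    - exact: indS.
  by have := maxS _ PS'; rewrite cardsU1 vS /t /= add1n ltnn.
have xy : e x y by have := SN _ yS; rewrite inE.
apply/existsP; exists (x |: B y); rewrite !in_setU1 eqxx vB orbT /=.
apply/andP; split.
  apply/cliqueP => a b; rewrite !in_setU1.
  case/orP => [/eqP->|aB]; case/orP => [/eqP->|bB]; rewrite ?eqxx // => ab.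
  - by move: bB; rewrite !inE => /andP [].
  - by move: aB; rewrite !inE sym => /andP [].
  - exact: (Bclique y).
have sB : (nbrs e x :&: nbrs e y) :\: U y \subset B y.
  apply/subsetP => w; rewrite inE => /andP [wU]; rewrite !inE => /andP [xw yw].
  rewrite xw yw /=; apply/forall_inP => z zS; apply: contra wU => zw.
  by apply/bigcupP; exists z => //; rewrite !inE yw.
have h : lam <= t * mu + #|x |: B y|.
  rewrite -(card_common_adj G xy) -(cardsID (U y) (nbrs e x :&: nbrs e y)).
  apply: leq_add; first exact: leq_trans (subset_leq_card (subsetIr _ _)) (cU _ yS).
  exact: leq_trans (subset_leq_card sB) (subset_leq_card (subsetUr _ _)).
(* By [t2], [4 * (t * mu) <= lam], so three quarters of [lam] remain. *)
rewrite -(leq_add2l (4 * (t * mu))); apply: leq_trans (_ : 4 * lam <= _).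
  by lia.
by rewrite -mulnDr leq_mul2l h.
Qed.

(** Every vertex of the union other than [u] and [v] is a common neighbour of these two adjacent
    vertices, so the union has at most [lam + 2] elements. *)
Lemma card_two_cliques (n k lam mu : nat) (e : rel 'I_n) (K L : {set 'I_n})
    (u v : 'I_n) :
  srg k lam mu e -> cliqueb e K -> cliqueb e L -> u != v ->
  u \in K -> v \in K -> u \in L -> v \in L ->
  #|K| + #|L| <= lam + 2 + #|K :&: L|.
Proof.
move=> G /cliqueP cK /cliqueP cL uv uK vK uL vL.
have [sym irr _ _ _] := G.
have euv : e u v by apply: cK.
rewrite -(cardsUI K L) leq_add2r.
apply: (@leq_trans #|u |: (v |: nbrs e u :&: nbrs e v)|).
  apply/subset_leq_card/subsetP => w; rewrite !inE => wKL.
  have [//|wu] := eqVneq w u; have [//|wv] := eqVneq w v; rewrite /=.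
  rewrite eq_sym in wu; rewrite eq_sym in wv.
  by case/orP: wKL => w0; [rewrite !cK | rewrite !cL].
rewrite !cardsU1 (card_common_adj G euv).
by case: (_ \notin _); case: (_ \notin _) => /=; lia.
Qed.

(** A vertex of [K] nonadjacent to [w] would share with [w] all the neighbours of [w] in [K], which
    are more than [mu]. *)
Lemma clique_extend (n k lam mu : nat) (e : rel 'I_n) (K : {set 'I_n})
    (w : 'I_n) :
  srg k lam mu e -> cliqueb e K -> mu < #|K :&: nbrs e w| ->
  cliqueb e (w |: K).
Proof.
move=> G /cliqueP cK hw; have [sym irr _ _ _] := G.
have wK : {in K, forall z, w != z -> e w z}.
  move=> z zK wz; apply: contraT => ewz.
  suff : #|K :&: nbrs e w| <= mu by lia.
  rewrite -(card_common_nonadj G wz ewz).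
  apply/subset_leq_card/subsetP => v; rewrite !inE => /andP [vK wv].
  rewrite wv /=; apply: cK => //; apply: contraNneq ewz => ->.
  exact: wv.
apply/cliqueP => a b; rewrite !in_setU1.
case/orP => [/eqP->|aK]; case/orP => [/eqP->|bK]; rewrite ?eqxx // => ab.
- exact: wK.
- by rewrite sym wK // eq_sym.
- exact: cK.
Qed.

Lemma double_count (I J : finType) (A : {set I}) (B : {set J})
    (p : I -> J -> bool) :
  \sum_(i in A) #|[set j in B | p i j]| = \sum_(j in B) #|[set i in A | p i j]|.
Proof.
transitivity (\sum_(i in A) \sum_(j in B) p i j).
  apply: eq_bigr => i _; rewrite -sum1dep_card big_mkcondr /=.
  by apply: eq_bigr => j _; case: (p i j).
rewrite exchange_big /=; apply: eq_bigr => j _.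
rewrite -sum1dep_card big_mkcondr /=.
by apply: eq_bigr => i _; case: (p i j).
Qed.

(* The large cliques joining [w] to the vertices of [T] pairwise meet only in
   [w]: two of them sharing another vertex would merge with [K], and then [w]
   would be adjacent to all of [K]. *)
Lemma card_large_cliques_through (n k lam mu : nat) (e : rel 'I_n)
    (K T : {set 'I_n}) (w : 'I_n) :
  srg k lam mu e -> 8 <= lam -> 128 * mu <= lam ->
  cliqueb e K -> ~~ cliqueb e (w |: K) -> 3 * lam <= 4 * #|K| -> T \subset K ->
  (forall y, y \in T -> in_large_clique lam e y w) ->
  #|T| * lam <= 2 * k.
Proof.
move=> G lam8 hmu cK nK cardK /subsetP TK goodT.
have [sym irr deg _ _] := G.
have wK : w \notin K.
  by apply: contra nK => wK; rewrite (setUidPr _) // sub1set.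
(* The default [set0] never arises for [y] in [T]. *)
pose L y := odflt set0 [pick L : {set 'I_n} |
    [&& cliqueb e L, y \in L, w \in L & 3 * lam <= 4 * #|L|]].
have LP y : y \in T ->
    [/\ cliqueb e (L y), y \in L y, w \in L y & 3 * lam <= 4 * #|L y|].
  move=> /goodT /existsP [M hM]; rewrite /L; case: pickP => [M' /and4P []//|].
  by move/(_ M); rewrite hM.
have disj y z v : y \in T -> z \in T -> v != w -> v \in L y -> v \in L z ->
    y = z.
  move=> yT zT vw vy vz; apply/eqP; apply: contraNT nK => yz.
  have [cy yy wy hy] := LP _ yT; have [cz zz wz hz] := LP _ zT.
  (* The spare 1 in [mu.+1] pays for [z], which may lie in both cliques but is not its own
     neighbour. *)
  have arith (a b c : nat) : 3 * lam <= 4 * a -> 3 * lam <= 4 * b ->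
      a + b <= lam + 2 + c -> mu.+1 < c.
    by move: lam8 hmu; clear; lia.
  have I1 := arith _ _ _ hy hz (card_two_cliques G cy cz vw vy wy vz wz).
  have cM : cliqueb e (z |: L y).
    apply: clique_extend G cy _; rewrite -ltnS; apply: leq_trans I1 _.
    apply: leq_trans (_ : #|z |: (L y :&: nbrs e z)| <= _).
      apply/subset_leq_card/subsetP => u; rewrite !inE => /andP [uy uz].
      have [//|uNz] := eqVneq u z; rewrite uy /=; apply: (cliqueP _ _ cz) => //.
      by rewrite eq_sym.
    by rewrite cardsU1; case: (_ \notin _).
  have hM : 3 * lam <= 4 * #|z |: L y|.
    by apply: leq_trans hy _; rewrite leq_mul2l subset_leq_card // subsetUr.
  have yM : y \in z |: L y by rewrite in_setU1 yy orbT.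
  (* Second merge: [K] and [z |: L y] share [y] and [z], so they overlap in more than [mu] vertices,
     all adjacent to [w]. *)
  have I2 := arith _ _ _ cardK hM
    (card_two_cliques G cK cM yz (TK _ yT) (TK _ zT) yM (setU11 _ _)).
  apply: clique_extend G cK _; apply: ltnW; apply: leq_trans I2 _.
  apply/subset_leq_card/subsetP => u; rewrite !inE => /andP [uK uM].
  rewrite uK /=; apply: (cliqueP _ _ cM); rewrite ?in_setU1 ?wy ?orbT //.
  by apply: contraNneq wK => ->.
have cD y : y \in T -> lam <= 2 * #|[set v in nbrs e w | v \in L y]|.
  move=> yT; have [cy yy wy hy] := LP _ yT.
  have sub : L y :\ w \subset [set v in nbrs e w | v \in L y].
    apply/subsetP => v /setD1P [vw vy]; rewrite !inE vy andbT.
    by apply: (cliqueP _ _ cy) => //; rewrite eq_sym.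
  have arith (a b : nat) : 3 * lam <= 4 * (1 + a) -> a <= b -> lam <= 2 * b.
    by move: lam8; clear; lia.
  apply: arith (subset_leq_card sub).
  by move: hy; rewrite (cardsD1 w (L y)) wy.
apply: leq_trans (_ : 2 * \sum_(y in T) #|[set v in nbrs e w | v \in L y]| <= _).
  by rewrite big_distrr -sum_nat_const; apply: leq_sum.
(* By [disj] each neighbour of [w] is counted for at most one [y], so the total is at most [k]. *)
rewrite leq_mul2l /= double_count -(deg w) -sum1_card; apply: leq_sum => v.
rewrite inE => wv; apply/card_le1_eqP => y z; rewrite !inE.
move=> /andP [yT vy] /andP [zT vz]; apply: (disj _ _ v) => //.
by apply: contraTneq wv => ->; rewrite irr.
Qed.

(** Counting the edges that leave a maximum clique [K] inside large cliques gives
    [#|K| * k / 2 <= n * (2 * k / lam)], while [#|K|] is at least [3 * lam / 4]. *)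
Lemma srg_lam_sqr_le (n k lam mu : nat) (e : rel 'I_n) :
  srg k lam mu e -> 0 < n -> 8 <= lam -> 4 * lam <= k ->
  32 * (k * mu) <= lam ^ 2 -> lam ^ 2 <= 8 * n.
Proof.
move=> G n0 lam8 lamk hkmu; have [sym irr deg _ _] := G.
have lam0 : 0 < lam by lia.
have hmu : 128 * mu <= lam.
  rewrite -(leq_pmul2r lam0); have := leq_mul lamk (leqnn mu); lia.
have bad x := card_not_in_large_clique x G lam0 hkmu.
have c0 : cliqueb e set0 by apply/cliqueP => u v; rewrite inE.
case: (@arg_maxnP _ set0 (cliqueb e) (fun S => #|S|) c0) => K cK maxK.
(* Without a large clique at [x] all [k] neighbours would be exceptional, yet at most [k / 8]
   are. *)
have hK : 3 * lam <= 4 * #|K|.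
  pose x : 'I_n := Ordinal n0.
  have [v vN] : exists v, in_large_clique lam e x v.
    apply/existsP; apply: contraT => /existsPn nv.
    have := bad x; have -> : [set v in nbrs e x | ~~ in_large_clique lam e x v]
      = nbrs e x by apply/setP => v; rewrite inE nv andbT.
    by rewrite deg; lia.
  case/existsP: vN => L /and4P [cL _ _ hL]; apply: leq_trans hL _.
  by rewrite leq_mul2l /=; apply: maxK.
have K2 : 1 < #|K| by rewrite -(leq_pmul2l (isT : 0 < 4)); lia.
have hK2 : #|K| <= lam + 2.
  case/card_gt1P: K2 => u [v [uK vK uv]].
  by have := card_two_cliques G cK cK uv uK vK uK vK; rewrite setIid leq_add2r.
pose g y w := [&& w \notin K, e y w & in_large_clique lam e y w].
(* At most [lam + 2 <= 5 * k / 16] neighbours of [y] lie in [K], and at most [k / 8] are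
   exceptional. *)
have hg y : k <= 2 * #|[set w in [set: 'I_n] | g y w]|.
  have sub : nbrs e y \subset [set w in [set: 'I_n] | g y w] :|:
      (K :|: [set v in nbrs e y | ~~ in_large_clique lam e y v]).
    apply/subsetP => w; rewrite !inE /g => ->; rewrite /=.
    by case: (w \in K); case: (in_large_clique _ _ _ _).
  have arith (a b c : nat) : b <= lam + 2 -> 8 * c <= k -> k <= a + (b + c) ->
    k <= 2 * a by lia.
  apply: arith hK2 (bad y) _.
  rewrite -{1}(deg y); apply: leq_trans (subset_leq_card sub) _.
  apply: leq_trans (leq_card_setU _ _) _.
  by rewrite leq_add2l leq_card_setU.
have hT w : #|[set y in K | g y w]| * lam <= 2 * k.
  have [wK|wK] := boolP (w \in K).
    rewrite (_ : [set y in K | g y w] = set0) ?cards0 //.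
    by apply/setP => y; rewrite !inE /g wK andbF.
  apply: (card_large_cliques_through (w := w) G lam8 hmu cK _ hK).
  - by apply/negP => /maxK; rewrite cardsU1 wK /= add1n ltnn.
  - by apply/subsetP => y; rewrite inE => /andP [].
  - by move=> y; rewrite inE => /andP [_ /and3P []].
have h1 : #|K| * k <= 2 * \sum_(w in [set: 'I_n]) #|[set y in K | g y w]|.
  rewrite -double_count big_distrr -sum_nat_const; apply: leq_sum => y _.
  exact: hg.
have h2 : (\sum_(w in [set: 'I_n]) #|[set y in K | g y w]|) * lam <= n * (2 * k).
  rewrite big_distrl /=; apply: leq_trans (_ : \sum_(w in [set: 'I_n]) 2 * k <= _).
    by apply: leq_sum => w _; apply: hT.
  by rewrite sum_nat_const cardsT card_ord.
have arith (a b : nat) : 3 * lam <= 4 * a -> a * k <= 2 * b ->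
    b * lam <= n * (2 * k) -> lam ^ 2 <= 8 * n.
  move=> i1 i2 i3; have k0 : 0 < k by lia.
  have i4 : a * lam <= 4 * n.
    rewrite -(leq_pmul2r k0); have := leq_mul i2 (leqnn lam); lia.
  have := leq_mul i1 (leqnn lam); lia.
exact: arith hK h1 h2.
Qed.

Import Order.TTheory GRing.Theory Num.Theory.
Local Open Scope ring_scope.

(** * The adjacency matrix *)

(** Rank factorizations make the entries inner products; a product of two inner products is the
    inner product of tensor products, in dimension [\rank A * \rank B]. *)
Lemma mxrank_hadamard (F : fieldType) (m n : nat) (A B : 'M[F]_(m, n)) :
  (\rank (map2_mx *%R A B) <= \rank A * \rank B)%N.
Proof.
pose P := \matrix_(i < m)
  mxvec (\matrix_(a < \rank A, b < \rank B) (col_base A i a * col_base B i b)).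
pose Q := \matrix_(j < n)
  mxvec (\matrix_(a < \rank A, b < \rank B) (row_base A a j * row_base B b j)).
suff -> : map2_mx *%R A B = P *m Q^T by apply: mulmx_max_rank.
apply/matrixP => i j; rewrite !mxE.
rewrite -{1}(mulmx_base A) -{1}(mulmx_base B) !mxE.
transitivity (\sum_a \sum_b P i (mxvec_index a b) * Q^T (mxvec_index a b) j).
  rewrite big_distrl /=; apply: eq_bigr => a _; rewrite big_distrr /=.
  by apply: eq_bigr => b _; rewrite !mxE !mxvecE !mxE mulrACA.
rewrite pair_bigA (reindex _ (curry_mxvec_bij _ _)) /=.
by apply: eq_bigr => -[a b] _.
Qed.

(** In a full-rank factorization [E = C *m Q], idempotence forces [Q *m C = 1%:M], and the trace is
    cyclic. *)
Lemma mxrank_idempotent (F : fieldType) (n : nat) (E : 'M[F]_n) :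
  E *m E = E -> (\rank E)%:R = \tr E.
Proof.
move: (mulmx_base E) (col_base_full E) (row_base_free E).
move: (col_base E) (row_base E); move: (\rank E) => p C Q <- Cfull Qfree EE.
have inj := row_free_inj Qfree; have QC : Q *m C = 1%:M.
  apply: (row_full_inj Cfull); apply: inj.
  by rewrite mulmx1 mulmxA -mulmxA EE.
by rewrite mxtrace_mulC QC mxtrace_scalar.
Qed.

Lemma adjmx_sqr (R : realFieldType) (n k lam mu : nat) (e : rel 'I_n) :
  srg k lam mu e ->
  adjmx R e *m adjmx R e = (lam%:R - mu%:R) *: adjmx R e
    + (k%:R - mu%:R)%:M + mu%:R *: const_mx 1.
Proof.
move=> G; have [sym irr deg _ _] := G; apply/matrixP => i j; rewrite !mxE.
have -> : \sum_l adjmx R e i l * adjmx R e l j = #|nbrs e i :&: nbrs e j|%:R.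
  rewrite -sum1_card natr_sum [RHS]big_mkcond /=; apply: eq_bigr => l _.
  by rewrite !mxE !inE (sym l j); case: (e i l); case: (e j l);
     rewrite ?mulr1 ?mulr0 ?mul0r.
have [->|ij] := eqVneq i j; first by rewrite setIid deg irr /= ?mulr1n; ring.
have [eij|eij] := boolP (e i j).
  by rewrite (card_common_adj G eij) /= mulr0n; ring.
by rewrite (card_common_nonadj G ij eij) /= mulr0n; ring.
Qed.

Lemma adjmx_sym (R : realFieldType) (n : nat) (e : rel 'I_n) :
  symmetric e -> (adjmx R e)^T = adjmx R e.
Proof. by move=> sym; apply/matrixP => i j; rewrite !mxE sym. Qed.

Lemma adjmx_mul1 (R : realFieldType) (n p k lam mu : nat) (e : rel 'I_n) :
  srg k lam mu e ->
  adjmx R e *m (const_mx 1 : 'M_(n, p)) = k%:R *: const_mx 1.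
Proof.
case=> _ _ deg _ _; apply/matrixP => i j; rewrite !mxE mulr1 -(deg i).
rewrite -sum1_card natr_sum [RHS]big_mkcond /=; apply: eq_bigr => l _.
by rewrite !mxE !inE mulr1; case: (e i l).
Qed.

Lemma mul1_adjmx (R : realFieldType) (n p k lam mu : nat) (e : rel 'I_n) :
  srg k lam mu e ->
  (const_mx 1 : 'M_(p, n)) *m adjmx R e = k%:R *: const_mx 1.
Proof.
move=> G; have [sym _ _ _ _] := G; apply: trmx_inj.
by rewrite trmx_mul linearZ /= !trmx_const adjmx_sym // (adjmx_mul1 _ _ G).
Qed.

Lemma const_mx1_mul (R : realFieldType) (m n p : nat) :
  (const_mx 1 : 'M[R]_(m, n)) *m (const_mx 1 : 'M_(n, p)) = n%:R *: const_mx 1.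
Proof.
apply/matrixP => i j; rewrite !mxE mulr1.
by under eq_bigr do rewrite !mxE mulr1; rewrite sumr_const card_ord.
Qed.

Lemma srg_degree_eq (R : realFieldType) (n k lam mu : nat) (e : rel 'I_n) :
  srg k lam mu e -> (0 < n)%N ->
  k%:R ^+ 2 = (lam%:R - mu%:R) * k%:R + (k%:R - mu%:R) + mu%:R * n%:R :> R.
Proof.
move=> G n0; pose u : 'cV[R]_n := const_mx 1.
have := congr1 (mulmx^~ u) (adjmx_sqr R G).
rewrite !mulmxDl -!scalemxAl mul_scalar_mx -mulmxA (adjmx_mul1 _ _ G).
rewrite -scalemxAr (adjmx_mul1 _ _ G) const_mx1_mul.
move/matrixP/(_ (Ordinal n0) ord0); rewrite !mxE !mulr1 => h.
by rewrite expr2 h.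
Qed.

(** An eigenvector for [a != k] is orthogonal to the all-ones vector, which kills the last term of
    [adjmx_sqr]. *)
Lemma eigenvalue_quadratic (R : realFieldType) (n k lam mu : nat)
    (e : rel 'I_n) (a : R) :
  srg k lam mu e -> eigenvalue (adjmx R e) a -> a != k%:R ->
  a ^+ 2 = (lam%:R - mu%:R) * a + (k%:R - mu%:R).
Proof.
move=> G /eigenvalueP [v va v0] ak.
have v1 p : v *m (const_mx 1 : 'M_(n, p)) = 0.
  have : (a - k%:R) *: (v *m (const_mx 1 : 'M_(n, p))) = 0.
    by rewrite scalerBl scalemxAl -va -mulmxA (adjmx_mul1 _ _ G) scalemxAr subrr.
  by move/eqP; rewrite scaler_eq0 subr_eq0 (negbTE ak) /= => /eqP.
have := congr1 (mulmx v) (adjmx_sqr R G).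
rewrite !mulmxDr mulmxA va -scalemxAl va -!scalemxAr va v1 scaler0 addr0.
rewrite mul_mx_scalar !scalerA -scalerDl => /eqP.
rewrite -subr_eq0 -scalerBl scaler_eq0 (negbTE v0) orbF subr_eq0 => /eqP.
by rewrite expr2.
Qed.

Lemma srg_nonadj_exists (n k lam mu : nat) (e : rel 'I_n) :
  srg k lam mu e -> (k.+1 < n)%N -> exists x y, x != y /\ ~~ e x y.
Proof.
move=> [_ _ deg _ _] kn; have n0 : (0 < n)%N by lia.
pose x : 'I_n := Ordinal n0; exists x.
have : (#|x |: nbrs e x| < #|[set: 'I_n]|)%N.
  rewrite cardsT card_ord; apply: leq_ltn_trans kn.
  by rewrite cardsU1 deg; case: (_ \notin _).
move=> h; have /subsetPn [y _ yn] : ~~ ([set: 'I_n] \subset x |: nbrs e x).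
  by apply: contraL h => /subset_leq_card; rewrite leqNgt.
by exists y; move: yn; rewrite !inE negb_or eq_sym => /andP [].
Qed.

Lemma srg_adj_exists (n k lam mu : nat) (e : rel 'I_n) :
  srg k lam mu e -> (0 < n)%N -> (0 < k)%N -> exists x y, e x y.
Proof.
move=> [_ _ deg _ _] n0; rewrite -(deg (Ordinal n0)) => /card_gt0P [y].
by rewrite inE => h; exists (Ordinal n0), y.
Qed.

Lemma srg_mu_le (n k lam mu : nat) (e : rel 'I_n) :
  srg k lam mu e -> (k.+1 < n)%N -> (mu <= k)%N.
Proof.
move=> G kn; have [x [y [xy exy]]] := srg_nonadj_exists G kn.
have [_ _ deg _ _] := G.
rewrite -(card_common_nonadj G xy exy) -(deg x).
exact/subset_leq_card/subsetIl.
Qed.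

Lemma srg_lam_lt (n k lam mu : nat) (e : rel 'I_n) :
  srg k lam mu e -> (0 < n)%N -> (0 < k)%N -> (lam < k)%N.
Proof.
move=> G n0 k0; have [x [y exy]] := srg_adj_exists G n0 k0.
have [_ irr deg _ _] := G.
rewrite -(card_common_adj G exy) -(deg x); apply/proper_card/properP; split.
  exact: subsetIl.
by exists y; rewrite !inE // irr andbF.
Qed.

(** If [r != k], both are roots of the same quadratic and Vieta applies. The remaining work excludes
    [r = k]; disjoint unions of complete graphs, where [s = -1], show why [s != -1] is assumed. *)
Lemma srg_restricted_eigenvalues (R : realFieldType) (n k lam mu : nat)
    (e : rel 'I_n) (r s : R) :
  srg k lam mu e -> (0 < k)%N -> (k.*2 < n)%N ->
  eigenvalue (adjmx R e) r -> eigenvalue (adjmx R e) s ->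
  (forall a : R, eigenvalue (adjmx R e) a -> [\/ a = k%:R, a = r | a = s]) ->
  s < r -> r <= k%:R -> s != -1 ->
  r + s = lam%:R - mu%:R /\ r * s = mu%:R - k%:R.
Proof.
move=> G k0 kn er es only sr rk sN1.
have n0 : (0 < n)%N by lia.
have kn1 : (k.+1 < n)%N by lia.
have sk : s != k%:R by rewrite lt_eqF // (lt_le_trans sr).
have qs := eigenvalue_quadratic G es sk.
have [rEk|rNk] := eqVneq r k%:R; last first.
  have qr := eigenvalue_quadratic G er rNk.
  have rs0 : r - s != 0 by rewrite subr_eq0 gt_eqF.
  have h : r + s = lam%:R - mu%:R.
    by apply: (mulIf rs0); apply/eqP; rewrite -subr_eq0; apply/eqP; ring: qr qs.
  split=> //; have -> : r = lam%:R - mu%:R - s by rewrite -h addrK.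
  by rewrite mulrBl -expr2 qs; ring.
(* [t] is the other root of the quadratic satisfied by [s]. *)
exfalso; pose t : R := lam%:R - mu%:R - s.
have ts : t * s = mu%:R - k%:R.
  by rewrite /t mulrBl -expr2 qs; ring.
have deq := srg_degree_eq R G n0.
have [et|net] := boolP (eigenvalue (adjmx R e) t).
  have {only} : t = k%:R \/ t = s by case: (only _ et); rewrite ?rEk; tauto.
  case=> tE.
    (* If [k] is itself a root, then [mu = 0], and the product of the roots gives [s = -1]. *)
    have lm : lam%:R - mu%:R = k%:R + s :> R by rewrite -tE /t subrK.
    have /eqP : mu%:R * n%:R = 0 :> R.
      have : k%:R ^+ 2 = (k%:R + s) * k%:R + (k%:R - mu%:R) + mu%:R * n%:R :> R.
        by rewrite -lm.
      by move: ts; rewrite tE => ts; lra.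
    rewrite -natrM pnatr_eq0 muln_eq0 [n == _]eqn0Ngt n0 orbF => /eqP mu0.
    move: ts; rewrite tE mu0 sub0r => ks; move/eqP: sN1; apply.
    have kn0 : k%:R != 0 :> R by rewrite pnatr_eq0 -lt0n.
    by apply: (mulfI kn0); rewrite ks mulrN1.
  (* A double root has square [mu - k <= 0], so [s = 0] and [lam = mu = k], against [lam < k]. *)
  have muk : mu%:R <= k%:R :> R by rewrite ler_nat (srg_mu_le G).
  have s0 : s = 0.
    apply/eqP; rewrite -sqrf_eq0 eq_le sqr_ge0 andbT expr2.
    by move: ts; rewrite tE => ->; rewrite subr_le0.
  have lm : lam = mu.
    by apply/eqP; rewrite -(eqr_nat R) -subr_eq0; move: tE; rewrite /t s0 subr0 => ->.
  have mk : mu = k.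
    apply/eqP; rewrite -(eqr_nat R) -subr_eq0.
    by move: ts; rewrite s0 mulr0 => <-.
  by have := srg_lam_lt G n0 k0; rewrite lm mk ltnn.
(* [A - t] is invertible and sends both [A - s] and a multiple of the all-ones
   matrix to the same matrix, so the graph is complete or empty. *)
have tk : k%:R - t != 0.
  by rewrite subr_eq0; apply: contraNneq net => <-; rewrite -rEk.
pose J : 'M[R]_n := const_mx 1.
have uni : adjmx R e - t%:M \in unitmx.
  by move: net; rewrite negbK kermx_eq0 row_free_unit.
have key : adjmx R e - s%:M = (mu%:R / (k%:R - t)) *: J.
  apply: (can_inj (mulKmx uni)).
  rewrite -scalemxAr mulmxBl mulmxBl mulmxBr (adjmx_sqr R G) (adjmx_mul1 _ _ G).
  rewrite !mul_scalar_mx mul_mx_scalar.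
  apply/matrixP => i j; rewrite !mxE.
  rewrite !mulr1 divfK //.
  have -> : lam%:R - mu%:R = t + s by rewrite subrK.
  have -> : k%:R - mu%:R = - (t * s) by rewrite ts opprB.
  by case: (i == j); rewrite ?mulr1n ?mulr0n; ring.
have [x [y [xy exy]]] := srg_nonadj_exists G kn1.
have [x' [y' exy']] := srg_adj_exists G n0 k0.
have x'y' : x' != y'.
  by have [_ irr _ _ _] := G; apply: contraTneq exy' => ->; rewrite irr.
have := congr1 (fun M : 'M_n => M x y) key.
have := congr1 (fun M : 'M_n => M x' y') key.
rewrite !mxE (negbTE xy) (negbTE x'y') (negbTE exy) exy' /= ?mulr0n !subr0 => <- /eqP.
by rewrite eq_sym oner_eq0.
Qed.

(* The absolute bound: the entries of [X := A - s] off the diagonal are [0] or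
   [1], so the entrywise product of [X] and [X - J] is [s (s + 1)] times the
   identity, whereas its rank is at most [rank X * rank (X - J)]. *)
Lemma srg_absolute_bound (R : realFieldType) (n k lam mu : nat)
    (e : rel 'I_n) (r s : R) :
  srg k lam mu e -> (0 < n)%N ->
  r + s = lam%:R - mu%:R -> r * s = mu%:R - k%:R ->
  s < r -> s != 0 -> s != -1 ->
  exists f : nat, f%:R * (r - s) = - (s * n%:R) - (k%:R - s) /\
    (n <= f.+1 * f.+2)%N.
Proof.
move=> G n0 rDs rMs sr s0 sN1; have [sym irr _ _ _] := G.
have rs0 : r - s != 0 by rewrite subr_eq0 gt_eqF.
have nR0 : n%:R != 0 :> R by rewrite pnatr_eq0 -lt0n.
pose J : 'M[R]_n := const_mx 1.
(* This [c] makes [X - c *: J] vanish on the all-ones vector, so that [E] is the spectral projection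
   for [r]; its trace yields the multiplicity. *)
pose c : R := (k%:R - s) / n%:R.
pose X : 'M[R]_n := adjmx R e - s%:M.
pose E : 'M[R]_n := (r - s)^-1 *: (X - c *: J).
have muE : mu%:R = c * (k%:R - r).
  have deq := srg_degree_eq R G n0.
  have h : mu%:R * n%:R = (k%:R - s) * (k%:R - r).
    rewrite -rDs in deq; have km : k%:R - mu%:R = - (r * s) by rewrite rMs opprB.
    rewrite km in deq; have -> : mu%:R * n%:R = k%:R ^+ 2 - (r + s) * k%:R + r * s.
      by rewrite deq; ring.
    by ring.
  by rewrite /c mulrAC -h mulfK.
have EE : E *m E = E.
  rewrite /E -scalemxAl -scalemxAr; congr (_ *: _).
  rewrite /X !mulmxBl !mulmxBr (adjmx_sqr R G) -!scalemxAl -!scalemxAr.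
  rewrite !mul_scalar_mx !mul_mx_scalar (adjmx_mul1 _ _ G) (mul1_adjmx _ _ G).
  rewrite const_mx1_mul; apply/matrixP => i j; rewrite !mxE.
  have -> : lam%:R - mu%:R = r + s by [].
  have -> : k%:R - mu%:R = - (r * s) by rewrite rMs opprB.
  by rewrite muE /c; case: (i == j); rewrite ?mulr1n ?mulr0n; field; rewrite nR0.
exists (\rank E); split.
  rewrite (mxrank_idempotent EE) /E linearZ /= mulrAC mulVf // mul1r.
  rewrite /X !linearB /= linearZ /= mxtrace_scalar.
  have -> : \tr (adjmx R e) = 0.
    by rewrite /mxtrace big1 // => i _; rewrite mxE irr.
  have -> : \tr J = n%:R.
    rewrite /mxtrace; under eq_bigr do rewrite mxE.
    by rewrite sumr_const card_ord.
  by rewrite sub0r /c divfK // mulr_natr.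
have rJ : (\rank J <= 1)%N.
  rewrite (_ : J = (const_mx 1 : 'cV_n) *m (const_mx 1 : 'rV_n)).
    exact: mulmx_max_rank.
  by rewrite const_mx1_mul scale1r.
have XE : X = (r - s) *: E + c *: J by rewrite scalerA mulfV // scale1r subrK.
(* Each use of the rank-one matrix [J] costs one: [X] has rank at most [f + 1], and [X - J] at most
   [f + 2]. *)
have rX : (\rank X <= (\rank E).+1)%N.
  rewrite XE -addn1; apply: leq_trans (mxrank_add _ _) _.
  apply: leq_add; apply: leq_trans (mxrank_scale _ _) _ => //.
have had : map2_mx *%R X (X - J) = (s * (s + 1))%:M.
  apply/matrixP => i j; rewrite !mxE.
  have [->|ij] := eqVneq i j; first by rewrite irr /= ?mulr0n ?mulr1n; ring.
  by case: (e i j); rewrite /= ?mulr0n ?mulr1n; ring.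
have := mxrank_hadamard X (X - J); rewrite had.
have -> : \rank ((s * (s + 1))%:M : 'M[R]_n) = n.
  by rewrite mxrank_unit // unitmxE det_scalar unitfE expf_neq0 // mulf_neq0 // addr_eq0.
move/leq_trans; apply; apply: leq_mul => //.
apply: leq_trans (mxrank_add _ _) _; rewrite -addn1; apply: leq_add => //.
by rewrite mxrank_opp.
Qed.

(** * Inequalities between the parameters *)

(** For [-1 <= s <= 0] both arms of the maximum are nonpositive. *)
Lemma claw_bound_lt (R : realFieldType) (mu r s : R) :
  0 < r -> s <= 0 -> 0 <= mu ->
  r <= Num.max (2 * (- s - 1) * (mu + 1 + s) + s)
               (s * (s + 1) * (mu + 1) / 2 - 1) ->
  s < -1.
Proof.
move=> r0 s0 mu0 h; rewrite ltNge; apply/negP => s1.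
move: h; rewrite le_max => /orP [] h.
  have : 0 <= (s + 1) * (mu + 1 + s) by apply: mulr_ge0; lra.
  by lra.
have : 0 <= (- s) * (s + 1) * (mu + 1).
  by apply: mulr_ge0; [apply: mulr_ge0|]; lra.
by lra.
Qed.

Lemma claw_bound_le (R : realFieldType) (mu r s : R) :
  s < -1 -> 1 <= mu ->
  r <= Num.max (2 * (- s - 1) * (mu + 1 + s) + s)
               (s * (s + 1) * (mu + 1) / 2 - 1) ->
  r <= 2 * (s ^+ 2 * mu).
Proof.
move=> s1 mu1 /le_trans; apply; rewrite ge_max; apply/andP; split.
  have h1 : 0 <= (- s - 1) * (- s - 1) by apply: mulr_ge0; lra.
  have h2 : 0 <= (s + 1) * s * mu.
    by apply: mulr_ge0; [rewrite -mulrNN; apply: mulr_ge0|]; lra.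
  have h3 : 0 <= mu by lra.
  by nra.
have h1 : 0 <= (- s) * (mu + 1) by apply: mulr_ge0; lra.
have h2 : 0 <= s ^+ 2 * (mu - 1) by apply: mulr_ge0; [exact: sqr_ge0|lra].
have h3 : 0 <= s ^+ 2 * mu by apply: mulr_ge0; [exact: sqr_ge0|lra].
by rewrite expr2 in h2 h3 *; lra.
Qed.

(** * Fractional powers and the three upper bounds on [r] *)

Lemma powR_exprn (R : realType) (a p : R) (m q : nat) :
  0 <= a -> p * m%:R = q%:R -> (a `^ p) ^+ m = a ^+ q.
Proof.
move=> a0 pmq.
by rewrite -powR_mulrn ?powR_ge0 // -powRrM pmq powR_mulrn.
Qed.

(** As [c <= c ^+ m] for [c >= 1], no root of the constant has to be taken. *)
Lemma ler_of_exprn (R : realFieldType) (c x y : R) (m : nat) :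
  (0 < m)%N -> 1 <= c -> 0 <= x -> 0 <= y -> x ^+ m <= c * y ^+ m -> x <= c * y.
Proof.
move=> m0 c1 x0 y0 h; have c0 : 0 <= c by lra.
rewrite -(ler_pXn2r m0) ?nnegrE ?mulr_ge0 //; apply: le_trans h _.
by rewrite exprMn ler_wpM2r ?exprn_ge0 // ler_eXnr.
Qed.

Lemma eigenvalue_cube_le (R : realFieldType) (n k mu r s : R) :
  0 <= n -> 0 <= mu -> 0 <= r -> r * s = mu - k -> mu <= k ->
  n * mu <= 3 * k ^+ 2 -> r <= 2 * (s ^+ 2 * mu) ->
  n * r ^+ 3 <= 6 * k ^+ 4.
Proof.
move=> n0 mu0 r0 rs muk nmu claw.
have h1 : n * r ^+ 2 * r <= n * r ^+ 2 * (2 * (s ^+ 2 * mu)).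
  by apply: ler_wpM2l => //; rewrite mulr_ge0 ?sqr_ge0.
have h2 : (k - mu) ^+ 2 * (n * mu) <= k ^+ 2 * (3 * k ^+ 2).
  apply: ler_pM => //; rewrite ?sqr_ge0 ?mulr_ge0 //.
  by apply: lerXn2r; rewrite ?nnegrE; lra.
have -> : n * r ^+ 3 = n * r ^+ 2 * r by ring.
apply: le_trans h1 _.
have -> : n * r ^+ 2 * (2 * (s ^+ 2 * mu)) = 2 * ((r * s) ^+ 2 * (n * mu)) by ring.
have -> : 6 * k ^+ 4 = 2 * (k ^+ 2 * (3 * k ^+ 2)) by ring.
by rewrite rs -sqrrN opprB ler_pM2l.
Qed.

Lemma eigenvalue_fourth_le (R : realFieldType) (n k mu r s : R) (f : nat) :
  0 < n -> 0 <= mu -> 0 <= r -> s <= 0 -> s <= k -> r * s = mu - k -> mu <= k ->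
  (0 < f)%N -> f%:R * (r - s) = - (s * n) - (k - s) ->
  n <= (f.+1 * f.+2)%:R ->
  r ^+ 4 <= 6 * k ^+ 2 * n.
Proof.
move=> n0 mu0 r0 s0 sk rs muk f0 hf nf.
have f0' : 0 <= f%:R :> R by rewrite ler0n.
have nf2 : n <= 6 * f%:R ^+ 2.
  apply: le_trans nf _; rewrite -natrX -natrM ler_nat.
  (* The constant 6 comes from [f + 1 <= 2 f] and [f + 2 <= 3 f]. *)
  have : (f.+1 * f.+2 <= (2 * f) * (3 * f))%N by apply: leq_mul; lia.
  by move/leq_trans; apply; rewrite mulnACA.
have fr : f%:R * r <= - s * n.
  have : f%:R * s <= 0 by apply: mulr_ge0_le0.
  by lra.
have h1 : (f%:R * r) ^+ 2 <= (- s * n) ^+ 2.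
  by apply: lerXn2r; rewrite ?nnegrE ?mulr_ge0 ?oppr_ge0 // ltW.
have h2 : r ^+ 2 <= 6 * (s ^+ 2 * n).
  rewrite -(ler_pM2l n0); apply: le_trans (_ : 6 * (f%:R * r) ^+ 2 <= _).
    have -> : 6 * (f%:R * r) ^+ 2 = 6 * f%:R ^+ 2 * r ^+ 2 by ring.
    by apply: ler_wpM2r => //; apply: sqr_ge0.
  have -> : n * (6 * (s ^+ 2 * n)) = 6 * (- s * n) ^+ 2 by ring.
  by rewrite ler_pM2l.
have h3 : r ^+ 2 * r ^+ 2 <= r ^+ 2 * (6 * (s ^+ 2 * n)).
  by apply: ler_wpM2l => //; apply: sqr_ge0.
have h4 : (k - mu) ^+ 2 <= k ^+ 2 by apply: lerXn2r; rewrite ?nnegrE; lra.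
have -> : r ^+ 4 = r ^+ 2 * r ^+ 2 by ring.
apply: le_trans h3 _.
have -> : r ^+ 2 * (6 * (s ^+ 2 * n)) = 6 * (r * s) ^+ 2 * n by ring.
rewrite rs -sqrrN opprB; apply: ler_wpM2r; first exact: ltW.
by rewrite ler_pM2l.
Qed.

(** Three regimes: if [k < 8 r] the cubic bound makes the graph dense; if [- s > r / 2] then
    [r ^+ 2 <= 2 k <= n]; otherwise [lam >= r / 2], and either the first alternative holds or the
    clique argument applies. *)
Lemma eigenvalue_sqr_le (R : realFieldType) (n k lam mu : nat) (e : rel 'I_n)
    (r s : R) :
  srg k lam mu e -> (0 < n)%N -> (0 < k)%N ->
  0 < r -> s <= 0 -> r + s = lam%:R - mu%:R -> r * s = mu%:R - k%:R ->
  2 * k%:R <= n%:R :> R -> r <= k%:R ->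
  n%:R * mu%:R <= 3 * k%:R ^+ 2 :> R ->
  n%:R * r ^+ 3 <= 6 * k%:R ^+ 4 ->
  n%:R * r ^+ 2 <= 3072 * k%:R ^+ 3 \/ r ^+ 2 <= 3072 * n%:R.
Proof.
move=> G n0 k0 r0 s0 rDs rMs kn rk nmu cube.
have nR1 : 1 <= n%:R :> R by rewrite ler1n.
have kR0 : 0 < k%:R :> R by rewrite ltr0n.
have nR0 : 0 < n%:R :> R by rewrite ltr0n.
have mu0 : 0 <= mu%:R :> R by rewrite ler0n.
have r2k : r ^+ 2 <= k%:R ^+ 2 by apply: lerXn2r; rewrite ?nnegrE; lra.
have [big|r8] := ltP k%:R (8 * r).
  (* Here [3072 = 8 ^ 3 * 6], with 6 from the cubic bound. *)
  left.
  have h1 : k%:R ^+ 3 <= (8 * r) ^+ 3 by apply: lerXn2r; rewrite ?nnegrE; lra.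
  have h2 : n%:R * k%:R ^+ 3 <= 3072 * k%:R * k%:R ^+ 3 :> R.
    apply: le_trans (_ : n%:R * (8 * r) ^+ 3 <= _); first by rewrite ler_pM2l.
    have -> : n%:R * (8 * r) ^+ 3 = 512 * (n%:R * r ^+ 3) by ring.
    have -> : 3072 * k%:R * k%:R ^+ 3 = 512 * (6 * k%:R ^+ 4) :> R by ring.
    by rewrite ler_pM2l.
  have h3 : n%:R <= 3072 * k%:R :> R by move: h2; rewrite ler_pM2r ?exprn_gt0.
  have h4 : n%:R * r ^+ 2 <= 3072 * k%:R * k%:R ^+ 2.
    by apply: ler_pM => //; rewrite ?sqr_ge0 // ltW.
  have : 0 <= k%:R ^+ 3 :> R by rewrite exprn_ge0 ?ltW.
  have -> : k%:R ^+ 3 = k%:R * k%:R ^+ 2 :> R by ring.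
  by lra.
have [sbig|ssmall] := ltP (r / 2) (- s).
  right; have : r * (r / 2) <= r * - s by rewrite ler_pM2l // ltW.
  by rewrite mulrN rMs expr2; lra.
have lamr : r / 2 <= lam%:R by lra.
have [?|hC] := leP (n%:R * r ^+ 2) (3072 * k%:R ^+ 3); first by left.
right; have kmu : 1024 * (k%:R * mu%:R) <= r ^+ 2.
  rewrite -(ler_pM2l nR0).
  have : k%:R * (n%:R * mu%:R) <= k%:R * (3 * k%:R ^+ 2) :> R by rewrite ler_pM2l.
  have -> : k%:R * (3 * k%:R ^+ 2) = 3 * k%:R ^+ 3 :> R by ring.
  have : 0 <= k%:R ^+ 3 :> R by rewrite exprn_ge0 ?ltW.
  by lra.
have r2 : r ^+ 2 <= 4 * lam%:R ^+ 2.
  have -> : 4 * lam%:R ^+ 2 = (2 * lam%:R) ^+ 2 :> R by ring.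
  by apply: lerXn2r; rewrite ?nnegrE; lra.
have hkmu : (32 * (k * mu) <= lam ^ 2)%N.
  rewrite -(ler_nat R) natrX !natrM.
  have : 0 <= k%:R * mu%:R :> R by rewrite mulr_ge0 ?ler0n.
  by lra.
(* Since [mu <= k / 1024] and [r <= k / 8], the sum [lam = r + s + mu] is below [k / 4]. *)
have lamk : (4 * lam <= k)%N.
  rewrite -(ler_nat R) natrM.
  have : k%:R * mu%:R <= k%:R * (k%:R / 1024) :> R.
    by move: kmu r2k; rewrite !expr2; lra.
  rewrite ler_pM2l //; lra.
have [lam8|lam8] := leqP 8 lam; last first.
  apply: le_trans r2 _.
  have : lam%:R ^+ 2 <= 8 ^+ 2 :> R.
    by apply: lerXn2r; rewrite ?nnegrE ?ler0n // ler_nat ltnW.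
  by lra.
have := srg_lam_sqr_le G n0 lam8 lamk hkmu.
rewrite -(ler_nat R) natrX natrM; lra.
Qed.

(** Raising to the powers 3, 4 and 2 clears the fractional exponents of the respective terms of the
    minimum. *)
Lemma le_gfun (R : realType) (n k : nat) (c x : R) :
  (0 < n)%N -> 1 <= c -> 0 <= x ->
  n%:R * x ^+ 3 <= c * k%:R ^+ 4 ->
  x ^+ 4 <= c * k%:R ^+ 2 * n%:R ->
  n%:R * x ^+ 2 <= c * k%:R ^+ 3 \/ x ^+ 2 <= c * n%:R ->
  x / n%:R <= c * gfun R n k.
Proof.
move=> n0 c1 x0 h1 h2 h3; have c0 : 0 <= c by lra.
have nR0 : 0 < n%:R :> R by rewrite ltr0n.
have kn0 : 0 <= k%:R / n%:R :> R by rewrite divr_ge0 ?ler0n.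
have xn0 : 0 <= x / n%:R by rewrite divr_ge0 ?ler0n.
have nN0 : n%:R != 0 :> R by rewrite gt_eqF.
rewrite /gfun !minr_pMr // maxr_pMr // !le_min le_max.
apply/and3P; split.
- apply: (@ler_of_exprn _ _ _ _ 3) => //; first exact: powR_ge0.
  rewrite (@powR_exprn _ _ _ 3 4) //; last by field.
  rewrite !expr_div_n mulrA ler_pdivrMr ?exprn_gt0 //.
  have -> : c * k%:R ^+ 4 / n%:R ^+ 4 * n%:R ^+ 3 = c * k%:R ^+ 4 / n%:R.
    by field.
  by rewrite ler_pdivlMr // mulrC.
- apply: (@ler_of_exprn _ _ _ _ 4) => //.
    by rewrite divr_ge0 ?powR_ge0.
  rewrite !expr_div_n (@powR_exprn _ _ _ 4 2) ?ler0n //; last by field.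
  rewrite (@powR_exprn _ _ _ 4 3) ?ler0n //; last by field.
  rewrite mulrA ler_pdivrMr ?exprn_gt0 //.
  have -> : c * k%:R ^+ 2 / n%:R ^+ 3 * n%:R ^+ 4 = c * k%:R ^+ 2 * n%:R.
    by field.
  exact: h2.
- case: h3 => h3; apply/orP; [left|right].
    apply: (@ler_of_exprn _ _ _ _ 2) => //; first exact: powR_ge0.
    rewrite (@powR_exprn _ _ _ 2 3) //; last by field.
    rewrite !expr_div_n mulrA ler_pdivrMr ?exprn_gt0 //.
    have -> : c * k%:R ^+ 3 / n%:R ^+ 3 * n%:R ^+ 2 = c * k%:R ^+ 3 / n%:R.
      by field.
    by rewrite ler_pdivlMr // mulrC.
  apply: (@ler_of_exprn _ _ _ _ 2) => //; first exact: powR_ge0.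
  rewrite (@powR_exprn _ _ _ 2 1) ?divr_ge0 ?ler0n //; last by field.
  rewrite expr_div_n expr1 ler_pdivrMr ?exprn_gt0 //.
  have -> : c * (1 / n%:R) * n%:R ^+ 2 = c * n%:R by field.
  exact: h3.
Qed.

Lemma gfun_ge0 (R : realType) (n k : nat) : 0 <= gfun R n k.
Proof.
by rewrite /gfun !le_min le_max divr_ge0 ?powR_ge0.
Qed.

Theorem theorem19 (R : realType) :
  exists C : R, 0 < C /\
  forall (n k lam mu : nat) (e : rel 'I_n) (r s : R),
    @srg n k lam mu e ->
    (k%:R : R) <= (n%:R - 1) / 2 ->
    eigenvalue (adjmx R e) r -> eigenvalue (adjmx R e) s ->
    (forall a : R, eigenvalue (adjmx R e) a -> [\/ a = k%:R, a = r | a = s]) ->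
    s < r -> r <= k%:R ->
    r <= Num.max (2 * (- s - 1) * (mu%:R + 1 + s) + s)
                 (s * (s + 1) * (mu%:R + 1) / 2 - 1) ->
    r / n%:R <= C * gfun R n k.
Proof.
exists 3072; split; first by rewrite ltr0n.
move=> n k lam mu e r s G kn er es only sr rk claw.
have [r0|r0] := leP r 0.
  apply: le_trans (_ : 0 <= _); last by rewrite mulr_ge0 ?gfun_ge0 ?ler0n.
  by rewrite mulr_le0_ge0 ?invr_ge0 ?ler0n.
have kR0 : 0 < k%:R :> R by apply: lt_le_trans rk.
have k0 : (0 < k)%N by rewrite -(ltr0n R).
have kn2 : (k.*2 < n)%N by rewrite -(ler_nat R) -addn1 natrD -muln2 natrM; lra.
have n0 : (0 < n)%N by lia.
have kn1 : (k.+1 < n)%N by lia.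
have nR0 : 0 < n%:R :> R by rewrite ltr0n.
have mu0 : 0 <= mu%:R :> R by rewrite ler0n.
have muk : mu%:R <= k%:R :> R by rewrite ler_nat (srg_mu_le G).
(* At [s = -1] both arms of the claw bound equal [-1], while [r > 0]. *)
have sN1 : s != -1.
  apply: contraTneq claw => ->; rewrite -ltNge gt_max; apply/andP; split; lra.
have [rDs rMs] := srg_restricted_eigenvalues G k0 kn2 er es only sr rk sN1.
have s0 : s <= 0 by rewrite -(pmulr_rle0 _ r0) rMs subr_le0.
have s1 := claw_bound_lt r0 s0 mu0 claw.
have nmuE : n%:R * mu%:R = (k%:R - r) * (k%:R - s).
  have := srg_degree_eq R G n0; rewrite -rDs.
  have -> : k%:R - mu%:R = - (r * s) by rewrite rMs opprB.
  by rewrite !expr2; lra.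
(* If [mu = 0], then [nmuE] forces [r = k], and [r * s = - k] gives [s = -1]. *)
have mu1 : 1 <= mu%:R :> R.
  rewrite ler1n lt0n; apply: contra_neq sN1 => mE.
  have /eqP : (k%:R - r) * (k%:R - s) = 0 by rewrite -nmuE mE mulr0.
  have ks0 : k%:R - s != 0 by rewrite gt_eqF //; lra.
  rewrite mulf_eq0 (negbTE ks0) orbF subr_eq0 => /eqP kr.
  apply: (mulfI (lt0r_neq0 r0)); rewrite rMs mE kr; ring.
have lam0 : 0 <= lam%:R :> R by rewrite ler0n.
(* The factor 3 arises from [- s = r + mu - lam <= 2 k]. *)
have nmu : n%:R * mu%:R <= 3 * k%:R ^+ 2 :> R.
  rewrite nmuE; have -> : 3 * k%:R ^+ 2 = k%:R * (3 * k%:R) :> R by ring.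
  by apply: ler_pM; lra.
have cube := eigenvalue_cube_le (ltW nR0) mu0 (ltW r0) rMs muk nmu
  (claw_bound_le s1 mu1 claw).
have s_neq0 : s != 0 by rewrite lt_eqF //; lra.
have [f [hf nf]] := srg_absolute_bound G n0 rDs rMs sr s_neq0 sN1.
(* [f = 0] would give [n <= 2], but [n > k + 1 >= 2]. *)
have f0 : (0 < f)%N.
  rewrite lt0n; apply: contraTneq nf => ->; rewrite -ltnNge.
  by apply: leq_trans kn1; rewrite !ltnS.
have fourth : r ^+ 4 <= 6 * k%:R ^+ 2 * n%:R.
  apply: (eigenvalue_fourth_le nR0 mu0 (ltW r0) s0 _ rMs muk f0 hf).
    by lra.
  by rewrite ler_nat.
have six : 6 <= 3072 :> R by rewrite ler_nat.
apply: le_gfun => //.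
- by rewrite ler1n.
- exact: ltW.
- by apply: le_trans cube _; rewrite ler_wpM2r ?exprn_ge0 ?ler0n.
- apply: le_trans fourth _; rewrite ler_wpM2r ?ler0n //.
  by rewrite ler_wpM2r ?exprn_ge0 ?ler0n.
- apply: (eigenvalue_sqr_le G n0 k0 r0 s0) => //; lra.
Qed.
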